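(* Let $l \geq 1$ be an integer and let $S$ be a string of $l$ decimal digits. Then there exists a prime number $p$ whose decimal representation contains $S$ and which satisfies $$\frac{\log p}{\log \log p} \leq 5.7\, l^2 \times 10^l .$$
   Context: A string of $l$ decimal digits is a finite sequence of $l$ elements of $\{0,1,\dots,9\}$ (leading zeros are allowed). The decimal representation of a positive integer is its usual base-10 expansion without leading zeros; it contains $S$ if $S$ occurs in it as a block of consecutive digits. $\log$ denotes the natural logarithm. *)

(* Defs.v *)
From mathcomp Require Import all_boot.

Set Implicit Arguments.
Unset Strict Implicit.
Unset Printing Implicit Defensive.

(* Strings are written most significant digit first, hence the [rev]. *)
Definition digits_value (s : seq 'I_10) : nat :=
  \sum_(i < size s) nth ord0 (rev s) i * 10 ^ i.

(* The condition on [head] excludes leading zeros; as [head ord0 [::] = ord0],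
   it also excludes the empty string, so that 0 has no representation. *)
Definition decimal_rep (n : nat) (s : seq 'I_10) : Prop :=
  head ord0 s != ord0 /\ digits_value s = n.

Definition contains_string (n : nat) (t : seq 'I_10) : Prop :=
  exists2 s, decimal_rep n s & infix t s.

Lemma digits_value_rcons s d :
  digits_value (rcons s d) = digits_value s * 10 + d.
Proof.
rewrite /digits_value size_rcons big_ord_recl rev_rcons /= muln1 addnC.
congr (_ + _); rewrite big_distrl /=.
by apply: eq_bigr => i _; rewrite /bump /= add1n expnSr mulnA.
Qed.

Lemma decimal_rep_gt0 n s : decimal_rep n s -> 0 < n.
Proof.
case=> + <-; elim/last_ind: s => [|s d IHs] //; rewrite digits_value_rcons.
case: s IHs => [_ /=|c s IHs /= h0]; first by rewrite -lt0n addn_gt0 orbC => ->.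
by rewrite addn_gt0 muln_gt0 IHs.
Qed.

Lemma decimal_rep_exists n : 0 < n -> exists s, decimal_rep n s.
Proof.
elim/ltn_ind: n => n IHn n_gt0.
have lt10 : n %% 10 < 10 by rewrite ltn_mod.
have [lt_n|ge_n] := ltnP n 10.
  exists [:: Ordinal lt_n]; split; first by rewrite /= -val_eqE /= -lt0n.
  by rewrite /digits_value big_ord1 /= muln1.
have [] := IHn (n %/ 10); rewrite ?ltn_Pdiv ?divn_gt0 //.
move=> s [s0 sE]; exists (rcons s (Ordinal lt10)); split.
  by case: s s0 {sE}.
by rewrite digits_value_rcons sE /= -divn_eq.
Qed.

Lemma decimal_rep_unique n s t : decimal_rep n s -> decimal_rep n t -> s = t.
Proof.
elim/last_ind: s n t => [|s d IHs] n t; first by case.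
elim/last_ind: t => [|t e _] hs ht; first by case: ht.
have [h1 E1] := hs; have [h2 E2] := ht.
move: (E1); rewrite -E2 !digits_value_rcons => E.
have de : d = e.
  by apply: val_inj; move: (congr1 (modn^~ 10) E); rewrite /= !modnMDl !modn_small.
move: E; rewrite de => /addIn /eqP; rewrite eqn_pmul2r // => /eqP E.
have headP (u : seq 'I_10) c : head ord0 (rcons u c) != ord0 -> u = [::] \/ head ord0 u != ord0.
  by case: u => [|a u]; [left | right].
congr rcons; case: (headP _ _ h1) (headP _ _ h2) => [-> | s0] [-> | t0] // in E *.
- have := @decimal_rep_gt0 _ t (conj t0 erefl).
  by rewrite -E /digits_value big_ord0.
- have := @decimal_rep_gt0 _ s (conj s0 erefl).
  by rewrite E /digits_value big_ord0.
- exact: (IHs (digits_value t)).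
Qed.

(* Main.v *)
Require Import Defs.
From mathcomp Require Import all_boot all_order all_algebra.
From mathcomp Require Import all_classical all_reals all_analysis.
From mathcomp Require Import zify ring lra.
Import Order.TTheory GRing.Theory Num.Theory.

(* Put k = 10 l 10^l and D = l k + 4 l. A number in [10^(l k), 10^D) that does
   not contain S has its k lowest blocks of l digits all different from S, so
   there are at most 10^(4 l) (10^l - 1)^k <= 10^D / 1000^l of them. By
   Chebyshev's argument on the central binomial coefficient there are at least
   about 0.3 * 10^D / D primes below 10^D, which is more than that number plus
   10^(l k). So some prime p in [10^(l k), 10^D) contains S, and log p <=
   D log 10 and log p >= l k log 10 give the bound. *)

(** * Chebyshev's lower bound for the number of primes dividing a central binomial coefficient *)

(** Legendre's formula: the power [p ^ k] contributes [n.*2 %/ p ^ k] minus twice [n %/ p ^ k],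
    which is at most 1, and 0 once [p ^ k] exceeds [n.*2]. *)
Lemma logn_bin_double p n : prime p -> 0 < n ->
  logn p 'C(n.*2, n) <= trunc_log p n.*2.
Proof.
move=> p_pr n_gt0; have p_gt1 := prime_gt1 p_pr.
have le_n2 : n <= n.*2 by lia.
(* All factorials are expanded over one common range, so that the sums compare termwise; the added
   terms vanish. *)
have expand m : m <= n.*2 -> logn p m`! = \sum_(1 <= k < n.*2.+1) m %/ p ^ k.
  move=> le_m; rewrite logn_fact // [RHS](big_cat_nat (n := m.+1)) //=.
  rewrite [X in _ + X]big_nat [X in _ + X]big1 ?addn0 // => k /andP[lt_mk _].
  by rewrite divn_small // (leq_trans lt_mk) // ltnW // ltn_expl.
have := congr1 (logn p) (bin_fact le_n2).
have -> : n.*2 - n = n by lia.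
rewrite !lognM ?muln_gt0 ?fact_gt0 ?bin_gt0 // !expand // -big_split /=.
set t := trunc_log p n.*2.
have : \sum_(1 <= k < n.*2.+1) n.*2 %/ p ^ k <=
    \sum_(1 <= k < n.*2.+1) ((n %/ p ^ k + n %/ p ^ k) + (k <= t)).
  apply: leq_sum => k _.
  have [le_kt|lt_tk] := leqP k t.
    have pk_gt0 : 0 < p ^ k by rewrite expn_gt0 ltnW.
    rewrite -ltnS ltn_divLR //.
    have := divn_eq n (p ^ k); have := ltn_pmod n pk_gt0; nia.
  by rewrite divn_small // (leq_trans (trunc_log_ltn _ p_gt1)) // leq_exp2l.
rewrite [in leqRHS]big_split /= => + E.
rewrite -E addnC leq_add2l => /leq_trans; apply.
have -> : \sum_(1 <= k < n.*2.+1) (k <= t) = \sum_(1 <= k < n.*2.+1 | k <= t) 1.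
  by rewrite [RHS]big_mkcond; apply: eq_bigr => k _; case: (k <= t).
rewrite sum1_count -[leqRHS](size_iota 1 t) -size_filter.
apply: uniq_leq_size => [|k]; first by rewrite filter_uniq ?iota_uniq.
by rewrite mem_filter mem_index_iota mem_iota add1n => /and3P[le_kt -> _].
Qed.

Lemma leq_bin_double n : 0 < n ->
  'C(n.*2, n) <= n.*2 ^ size (primes 'C(n.*2, n)).
Proof.
move=> n_gt0; set c := 'C(_, _).
have c_gt0 : 0 < c by rewrite bin_gt0; lia.
rewrite [leqLHS]prod_prime_decomp // prime_decompE big_map /= big_seq.
have -> : n.*2 ^ size (primes c) = \prod_(p <- primes c | p \in primes c) n.*2.
  by rewrite -big_seq big_const_seq count_predT iter_muln_1.
apply: leq_prod => p; rewrite mem_primes => /and3P[p_pr _ _].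
apply: leq_trans (trunc_logP (prime_gt1 p_pr) _); last by lia.
by rewrite leq_exp2l ?prime_gt1 // logn_bin_double.
Qed.

Lemma expn4_leq_bin_double n : 0 < n -> 4 ^ n <= n.*2 * 'C(n.*2, n).
Proof.
elim: n => [//|[|n] IHn _] //.
have := IHn isT; set m := n.+1.
(* This recurrence multiplies the right-hand side by [4 * (2 * m + 1) / (2 * m)], which is more than
   4. *)
have E : m.+1 * 'C(m.+1.*2, m.+1) = 2 * (m.*2.+1 * 'C(m.*2, m)).
  have := mul_bin_diag m.*2.+2 m; have := mul_bin_down m.*2.+1 m.
  rewrite /= -doubleS.
  have -> : m.*2.+1 - m = m.+1 by lia.
  rewrite mulnC; nia.
by rewrite expnS; nia.
Qed.

(** * Blocks of digits, and counting the numbers that avoid one *)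

Lemma digits_value_cat s t :
  digits_value (s ++ t) = digits_value s * 10 ^ size t + digits_value t.
Proof.
elim/last_ind: t => [|t d IHt].
  by rewrite cats0 muln1 [digits_value [::]]big_ord0 addn0.
by rewrite -rcons_cat !digits_value_rcons IHt size_rcons expnS; ring.
Qed.

Lemma digits_value_lt s : digits_value s < 10 ^ size s.
Proof.
elim/last_ind: s => [|s d IHs]; first by rewrite /digits_value big_ord0.
by rewrite digits_value_rcons size_rcons expnS; have := ltn_ord d; lia.
Qed.

Lemma digits_value_inj s t :
  size s = size t -> digits_value s = digits_value t -> s = t.
Proof.
elim/last_ind: s t => [|s d IHs] t; first by case: t.
elim/last_ind: t => [|t e _]; rewrite !size_rcons // => -[sz].
rewrite !digits_value_rcons => E.
have [ltd lte] := (ltn_ord d, ltn_ord e).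
congr rcons; first by apply: IHs => //; lia.
by apply: val_inj => /=; lia.
Qed.

(** The lower bound on [n] puts the whole block inside the representation, so a block padded by
    absent leading zeros cannot occur. *)
Lemma contains_string_block n j (t : seq 'I_10) : 10 ^ (j + size t) <= n ->
  n %/ 10 ^ j %% 10 ^ size t = digits_value t -> contains_string n t.
Proof.
move=> le_n nE; have n_gt0 : 0 < n by apply: leq_trans le_n; rewrite expn_gt0.
have [s sP] := decimal_rep_exists n_gt0; exists s => //.
have [_ sE] := sP.
have le_s : j + size t <= size s.
  rewrite -(leq_exp2l (m := 10)) //; apply: leq_trans le_n _.
  by rewrite -sE ltnW // digits_value_lt.
pose c := drop (size s - j) s; pose u := take (size s - j) s.
have szc : size c = j by rewrite size_drop; lia.
have szu : size u = size s - j by rewrite size_takel; lia.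
pose b := drop (size u - size t) u; pose a := take (size u - size t) u.
have szb : size b = size t by rewrite size_drop; lia.
have sabc : s = a ++ b ++ c by rewrite catA !cat_take_drop.
have bt : b = t.
  apply: digits_value_inj => //; rewrite -nE -sE sabc catA digits_value_cat szc.
  have ltc := digits_value_lt c; have ltb := digits_value_lt b.
  rewrite szc in ltc; rewrite szb in ltb.
  by rewrite divnMDl ?expn_gt0 // (divn_small ltc) addn0 digits_value_cat szb
             modnMDl modn_small.
by apply/infixP; exists a, c; rewrite -bt.
Qed.

(** Numbers below [m * B ^ k] whose [k] lowest base-[B] digits all differ from [v], for [v < B]; a
    list, so that counting is a [size] computation. *)
Fixpoint avoiders (B v m k : nat) : seq nat :=
  if k is k'.+1
  then [seq q * B + d | q <- avoiders B v m k', d <- rem v (iota 0 B)]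
  else iota 0 m.

Lemma size_avoiders B v m k : v < B -> size (avoiders B v m k) = m * B.-1 ^ k.
Proof.
move=> ltvB; elim: k => [|k IHk]; first by rewrite size_iota muln1.
by rewrite size_allpairs IHk size_rem ?mem_iota // size_iota expnSr mulnA.
Qed.

Lemma mem_avoiders B v m k n : 0 < B -> n < m * B ^ k ->
  (forall i, i < k -> n %/ B ^ i %% B != v) -> n \in avoiders B v m k.
Proof.
move=> B_gt0; elim: k n => [|k IHk] n ltn nv; first by rewrite mem_iota; lia.
apply/allpairsP; exists (n %/ B, n %% B); rewrite /= -divn_eq; split => //.
  apply: IHk => [|i ltik]; first by rewrite ltn_divLR // -mulnA -expnSr.
  by rewrite -divnMA -expnS nv.
rewrite mem_rem_uniq ?iota_uniq // !inE mem_iota /= ltn_pmod // !andbT.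
by have := nv 0 isT; rewrite divn1.
Qed.

(** With [B = b + 1], the first two binomial terms of [(b + 1) ^ B] are [b ^ B] and [B * b ^ b],
    each at least [b ^ B]. *)
Lemma expn_pred_double B : 0 < B -> 2 * B.-1 ^ B <= B ^ B.
Proof.
case: B => // b _; have := expnDn b 1 b.+1; rewrite addn1 => ->.
rewrite big_ord_recl big_ord_recl /= bin0 bin1 subn0 subSS subn0.
by rewrite !exp1n !muln1 mul1n expnS; lia.
Qed.

Lemma leq_size_primes_bin d n : n = 5 * 10 ^ d ->
  3 * 10 ^ d <= d.+1 * (size (primes 'C(n.*2, n))).+1.
Proof.
move=> nE5; have n_gt0 : 0 < n by rewrite nE5 muln_gt0 expn_gt0.
have nE : n.*2 = 10 ^ d.+1 by rewrite nE5 expnS; lia.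
rewrite -(leq_exp2l (m := 10)) // !expnM.
apply: (@leq_trans (4 ^ n)).
  (* The factor 3 comes from [10 ^ 3 <= 4 ^ 5]. *)
  by rewrite nE5 [4 ^ _]expnM leq_exp2r // expn_gt0.
apply: leq_trans (expn4_leq_bin_double _ n_gt0) _.
by rewrite -nE expnS leq_mul2l leq_bin_double ?orbT.
Qed.

Lemma leq_primes_bin_double n p : 0 < n ->
  p \in primes 'C(n.*2, n) -> p <= n.*2.
Proof.
move=> n_gt0; rewrite -logn_gt0 => log_gt0.
have p_pr : prime p by move: log_gt0; rewrite lognE; case: prime.
have n2_gt0 : 0 < n.*2 by lia.
apply: leq_trans (trunc_logP (prime_gt1 p_pr) n2_gt0).
rewrite -[leqLHS]expn1 leq_exp2l ?prime_gt1 //.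
exact: leq_trans log_gt0 (logn_bin_double _ _ p_pr n_gt0).
Qed.

(** The power [10 * j] of [expn_pred_double], with [1000 <= 2 ^ 10]. *)
Lemma expn_pred_leq B j : 0 < B -> 1000 ^ j * B.-1 ^ (10 * j * B) <= B ^ (10 * j * B).
Proof.
move=> B_gt0; apply: (@leq_trans ((2 * B.-1 ^ B) ^ (10 * j))).
  rewrite expnMn -expnM [B * _]mulnC leq_mul //.
  by rewrite (expnM 2 10); case: j => [|j] //; rewrite leq_exp2r.
rewrite [10 * j * B]mulnC [leqRHS]expnM; case: j => [|j] //.
by rewrite leq_exp2r // expn_pred_double.
Qed.

Lemma sqr_leq_expn10 l : 10 * l ^ 2 <= 10 ^ l.
Proof.
case: l => [|l] //; elim: l => [|l IHl] //.
by rewrite [leqRHS]expnS; nia.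
Qed.

Lemma exists_prime_containing l (S : l.-tuple 'I_10) : 0 < l ->
  let k := 10 * l * 10 ^ l in
  exists p, [/\ prime p, contains_string p S &
    10 ^ (l * k) <= p < 10 ^ (l * k + 4 * l)].
Proof.
move=> l_gt0 k; set D := l * k + 4 * l; set B := 10 ^ l; set v := digits_value S.
have BkE : B ^ k = 10 ^ (l * k) by rewrite -expnM.
have D_gt0 : 0 < D by lia.
pose n := 5 * 10 ^ D.-1.
have n_gt0 : 0 < n by rewrite muln_gt0 expn_gt0.
have n2E : n.*2 = 10 ^ D by rewrite -(prednK D_gt0) expnS /n /=; lia.
pose P := primes 'C(n.*2, n).
have ltP p : p \in P -> p < 10 ^ D.
  move=> p_in; have := leq_primes_bin_double _ _ n_gt0 p_in.
  rewrite n2E leq_eqVlt => /orP[/eqP pE|//].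
  (* Equality would make the prime [p] a positive power of 10, hence even, hence 2. *)
  move: p_in; rewrite mem_primes => /and3P[p_pr _ _].
  have : 2 %| p by rewrite pE -n2E dvdn2 odd_double.
  rewrite dvdn_prime2 // pE => /eqP E.
  by have := @leq_pexp2l 10 1 D isT D_gt0; rewrite -E.
pose avoid p := all (fun i => p %/ B ^ i %% B != v) (iota 0 k).
have [/allP lowP|] := boolP (all (fun p => (p < B ^ k) || avoid p) P).
  exfalso.
  have szP : size P <= B ^ k + 10 ^ (4 * l) * B.-1 ^ k.
    rewrite -[X in X + _](size_iota 0) -(@size_avoiders B v); last first.
      by have := digits_value_lt S; rewrite size_tuple.
    rewrite -size_cat; apply: uniq_leq_size; first exact: primes_uniq.
    move=> p p_in; rewrite mem_cat mem_iota /= add0n.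
    case/orP: (lowP p p_in) => [->//|/allP avp]; apply/orP; right.
    apply: mem_avoiders; first by rewrite expn_gt0.
      by rewrite BkE -expnD addnC ltP.
    by move=> i ltik; apply: avp; rewrite mem_iota.
  have := leq_size_primes_bin _ _ (erefl n); rewrite prednK // -/P.
  have BX : B ^ 4 * B ^ k = 10 ^ D by rewrite BkE -expnM -expnD addnC [l * 4]mulnC.
  (* Since [k = 10 * l * B], [expn_pred_leq] with [j := l] gains the factor [1000 ^ l = B ^ 3]. *)
  have BY : B ^ 3 * (10 ^ (4 * l) * B.-1 ^ k) <= 10 ^ D.
    rewrite mulnCA -BX -[B ^ 4]expnM [l * 4]mulnC leq_mul2l.
    by rewrite [B ^ 3]expnAC expn_pred_leq ?expn_gt0 ?orbT.
  have TE : 10 ^ D = 10 * 10 ^ D.-1 by rewrite -expnS prednK.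
  have lB := sqr_leq_expn10 l; rewrite -/B in lB.
  have B10 : 10 <= B by rewrite -[leqLHS]expn1 leq_exp2l.
  have X_gt0 : 0 < B ^ k by rewrite expn_gt0; lia.
  have DB : D <= 2 * B ^ 2 by rewrite /D /k -/B; nia.
  have DB3 : 5 * D <= B ^ 3 by rewrite expnS; nia.
  have B3 : B ^ 4 = B * B ^ 3 by rewrite expnS.
  have T_gt0 : 0 < 10 ^ D.-1 by rewrite expn_gt0.
  (* With the powers as variables, [b3 * (1 + X + Y)] is at most [T / 10 + T / 10 + T = 12 * t],
     while [le3] makes [5 * D * s.+1] at least [15 * t]. *)
  move: (B ^ 3) (B ^ 4) (B ^ k) (10 ^ (4 * l) * _) (10 ^ D.-1) (10 ^ D) (size P)
    B3 BX BY TE X_gt0 DB3 szP T_gt0 => b3 b4 X Y t T s B3 BX BY TE X_gt0 DB3 szP T_gt0 le3.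
  have le1 : 5 * D * s.+1 <= b3 * (1 + X + Y) by apply: leq_mul => //; lia.
  have le2 : 10 * (b3 * X) <= T by rewrite -BX B3 -mulnA leq_mul2r B10 orbT.
  have le4 : b3 <= b3 * X by rewrite leq_pmulr.
  lia.
rewrite -has_predC => /hasP[p p_in /=]; rewrite negb_or -leqNgt.
move=> /andP[le_p /allPn[i]]; rewrite mem_iota /= add0n negbK => ltik /eqP pE.
exists p; split.
- by move: p_in; rewrite mem_primes => /and3P[].
(* The base-[B] digit of index [i] is the block of [l] decimal digits at position [l * i]. *)
- apply: (@contains_string_block _ (l * i)); rewrite size_tuple.
    apply: leq_trans le_p; rewrite BkE leq_exp2l //; nia.
  by rewrite expnM.
- by rewrite -BkE le_p ltP.
Qed.

Local Open Scope ring_scope.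

(** * Numerical bounds on logarithms and the final estimate *)

Lemma ln10_bounds (R : realType) :
  2 <= ln (10 : R) <= 27 / 10 /\ 5 <= ln (100 * ln (10 : R)).
Proof.
(* The constants follow from 1.1 <= e^(1/10) <= 1/0.9 alone. *)
pose a : R := expR (1 / 10).
have a_ge : 11 / 10 <= a by have := expR_ge1Dx (1 / 10 : R); rewrite -/a; lra.
have a_le : a <= 10 / 9.
  have : 9 / 10 <= a^-1 by rewrite -expRN; have := expR_ge1Dx (- (1 / 10) : R); lra.
  by rewrite -[a]invrK => h; rewrite invf_ple ?posrE ?invr_gt0 ?expR_gt0 //; lra.
have expE n : expR (n%:R / 10) = a ^+ n by rewrite /a -expRM_natl mulrA mulr1.
(* Exponents are doubled with rounding at each stage, to keep the rationals small. *)
have sq n c d : a ^+ n <= c -> c ^+ 2 <= d -> a ^+ (n + n) <= d.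
  have : 0 <= a ^+ n by rewrite exprn_ge0 ?expR_ge0.
  by rewrite exprD; nra.
have a5_le : a ^+ 5 <= 1694 / 1000.
  apply: (@le_trans _ _ ((10 / 9) ^+ 5)); last lra.
  by rewrite lerXn2r ?nnegrE ?expR_ge0 //; lra.
have a10_le : a ^+ 10 <= 287 / 100 by apply: (sq 5%N _ _ a5_le); lra.
have a20_le : a ^+ 20 <= 824 / 100 by apply: (sq 10%N _ _ a10_le); lra.
have a40_le : a ^+ 40 <= 6790 / 100 by apply: (sq 20%N _ _ a20_le); lra.
have a50_le : a ^+ 50 <= 200.
  rewrite -[50%N]/(40 + 10)%N exprD; apply: (@le_trans _ _ (6790 / 100 * (287 / 100))); last lra.
  by rewrite ler_pM ?exprn_ge0 ?expR_ge0.
have a27_ge : 10 <= a ^+ 27.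
  have a9_ge : 22 / 10 <= a ^+ 9.
    apply: (@le_trans _ _ ((11 / 10) ^+ 9)); first lra.
    by rewrite lerXn2r ?nnegrE ?expR_ge0 //; lra.
  rewrite -[27%N]/(9 * 3)%N exprM; apply: (@le_trans _ _ ((22 / 10) ^+ 3)); first lra.
  by rewrite lerXn2r ?nnegrE ?exprn_ge0 ?expR_ge0 //; lra.
have ln10_ge : 2 <= ln 10 :> R.
  rewrite -ler_expR lnK ?posrE //.
  by have -> : 2 = 20%:R / 10 :> R; [lra | rewrite expE; lra].
split.
  by rewrite ln10_ge /= -ler_expR lnK ?posrE // expE.
(* As [ln 10] is at least 2, it suffices that [a ^+ 50], which is e^5, is at most 200. *)
rewrite -ler_expR lnK ?posrE; last lra.
by have -> : 5 = 50%:R / 10 :> R; [lra | rewrite expE; lra].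
Qed.

Theorem theorem1 (R : realType) (l : nat) (hl : (1 <= l)%N)
    (S : l.-tuple 'I_10) :
  exists p : nat,
    [/\ prime p, contains_string p S &
        (ln p%:R / ln (ln p%:R) <= 57 / 10 * l%:R ^+ 2 * 10 ^+ l :> R)].
Proof.
have [p [p_pr Sp /andP[le_p lt_p]]] := exists_prime_containing l S hl.
exists p; split => //.
have [/andP[ln10_ge ln10_le] lnln_ge] := ln10_bounds R.
set B : R := 10 ^+ l; set T := l%:R ^+ 2 * B.
have p_gt0 : 0 < p%:R :> R by rewrite ltr0n prime_gt0.
have l1 : 1 <= l%:R :> R by rewrite ler1n.
have B10 : 10 <= B by rewrite /B -[leLHS]expr1 ler_weXn2l ?ler1n.
have lnp_ge : 10 * T * ln 10 <= ln p%:R.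
  have -> : 10 * T = (l * (10 * l * 10 ^ l))%:R :> R.
    by rewrite !natrM natrX /T /B; ring.
  by rewrite mulr_natl -lnXn // -natrX ler_ln ?posrE ?ltr0n ?expn_gt0 ?(prime_gt0 p_pr) ?ler_nat //.
have lnp_le : ln p%:R <= (10 * T + 4 * l%:R) * ln 10.
  have -> : 10 * T + 4 * l%:R = (l * (10 * l * 10 ^ l) + 4 * l)%:R :> R.
    by rewrite natrD !natrM natrX /T /B; ring.
  rewrite mulr_natl -lnXn // -natrX ler_ln ?posrE ?ltr0n ?expn_gt0 ?(prime_gt0 p_pr) ?ler_nat //.
  exact: ltnW.
have l2_ge : l%:R <= l%:R ^+ 2 :> R by rewrite expr2 ler_peMr.
have lT : l%:R * 10 <= T by rewrite ler_pM.
have lnlnp_ge : 5 <= ln (ln p%:R : R).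
  apply: le_trans lnln_ge _.
  have h : 100 * ln 10 <= ln p%:R :> R.
    by apply: le_trans lnp_ge; rewrite ler_pM2r; lra.
  by rewrite ler_ln ?posrE //; lra.
rewrite ler_pdivrMr; last lra.
apply: le_trans lnp_le _; apply: (@le_trans _ _ (57 / 10 * T * 5)); last first.
  have -> : 57 / 10 * l%:R ^+ 2 * B = 57 / 10 * T by rewrite /T; ring.
  by rewrite ler_wpM2l //; lra.
(* By [lT], [4 * l] is at most [4 / 10 * T]; then 10.4 times 2.7 is 28.08, below 28.5, which is 5.7
   times 5. *)
apply: (@le_trans _ _ (104 / 10 * T * (27 / 10))); last lra.
by rewrite ler_pM; lra.
Qed.
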